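(* Let $G=(V\cup\{s\},E)$ be a finite, connected, undirected, loop-free graph (multiple edges allowed) with sink $s\notin V$, and let $p\in(0,1)$. A stable configuration $\eta$ is stochastically recurrent if and only if there exists an orientation $O$ of $G$ such that $\eta$ is compatible with $O$. In other words, ${\sf Sto}(G)=\bigcup_O{\sf comp}(O)$, the union over all orientations $O$ of $G$.
   Context: $d^G(v)$ is the degree of $v$ (with multiplicity). A configuration is $\eta\in\mathbb{Z}_{\ge0}^V$; stable if $\eta_v\le d^G(v)$ for all $v\in V$; $\eta^{\max}=(d^G(v))_{v\in V}$. In the stochastic sandpile model with parameter $p$, a legal stochastic toppling at $x\in V$ (allowed when $\eta_x>d^G(x)$) chooses independently for each edge $e=\{x,y\}$ at $x$ a Bernoulli($p$) variable $B_e$, removes $\sum_eB_e$ grains from $x$ and adds $B_e$ grains to $y$ if $y\neq s$ (grains to $s$ disappear). The Markov chain on stable configurations: add one grain at a random vertex of $V$ (i.i.d., distribution with support $V$), then perform legal stochastic topplings until stable. ${\sf Sto}(G)$, the set of stochastically recurrent configurations, is the recurrent class of this chain containing $\eta^{\max}$. An orientation of $G$ orients each edge of $E$ (parallel edges independently, including edges at $s$); ${\sf in}_O(v)$ is the number of edges oriented into $v$. The lacking number of $\eta$ at $v\in V$ is $l_\eta(v)=d^G(v)-\eta_v$. A configuration $\eta$ is compatible with $O$ if ${\sf in}_O(v)\ge 1+l_\eta(v)$ for all $v\in V$; ${\sf comp}(O)$ denotes the set of stable configurations compatible with $O$. *)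

(* Defs.v *)
From HB Require Import structures.
From mathcomp Require Import all_boot all_order all_algebra.
From mathcomp Require Import all_classical all_reals all_analysis.

Set Implicit Arguments.
Unset Strict Implicit.
Unset Printing Implicit Defensive.

Import Order.TTheory GRing.Theory Num.Theory.
Import numFieldNormedType.Exports.

Local Open Scope classical_set_scope.
Local Open Scope ring_scope.

(* The vertex set V ∪ {s} is [option (vertex G)]: [None] is the sink s, and
   [vertex G] is V. Edges have their own type, which allows parallel edges; an
   edge is an unordered pair of distinct endpoints, so there are no loops. *)
Record sink_graph := SinkGraph {
  vertex : finType;
  edge : finType;
  ends : edge -> {set option vertex};
  card_ends : forall e, #|ends e| = 2%N }.

Definition adj_vertex (G : sink_graph) : rel (option (vertex G)) :=
  fun x y => [exists e : edge G, ends e == [set x; y]%SET].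

Definition connected_graph (G : sink_graph) : Prop :=
  forall x y : option (vertex G), connect (@adj_vertex G) x y.

Section Configurations.
Variable G : sink_graph.

Definition edges_at (v : vertex G) : {set edge G} :=
  [set e | Some v \in ends e]%SET.

Definition deg (v : vertex G) : nat := #|edges_at v|.

Definition config := {ffun vertex G -> nat}.

Definition stable (eta : config) : bool :=
  [forall v, (eta v <= deg v)%N].

Record stable_config := StableConfig {
  config_of :> config;
  config_ofP : stable config_of }.

HB.instance Definition _ := [isSub for config_of].
HB.instance Definition _ := [Countable of stable_config by <:].

Definition bounded_of (eta : stable_config) :
    {ffun vertex G -> 'I_#|edge G|.+1} :=
  [ffun v => inord (config_of eta v)].

Definition of_bounded (f : {ffun vertex G -> 'I_#|edge G|.+1}) :
    option stable_config :=
  insub [ffun v => f v : nat].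

Lemma bounded_ofK : pcancel bounded_of of_bounded.
Proof.
move=> eta; rewrite /of_bounded.
suff -> : [ffun v => bounded_of eta v : nat] = val eta by exact: valK.
apply/ffunP => v; rewrite !ffunE inordK // ltnS.
have /forallP/(_ v)/leq_trans := config_ofP eta; apply; exact: max_card.
Qed.

HB.instance Definition _ :=
  fintype.isFinite.Build stable_config (pcan_enumP bounded_ofK).

Lemma stable_max : stable [ffun v => deg v].
Proof. by apply/forallP => v; rewrite ffunE. Qed.

Definition eta_max : stable_config := StableConfig stable_max.

Definition add_grain (eta : config) (v : vertex G) : config :=
  [ffun y => (eta y + (y == v))%N].

(* [S] is the set of those edges [e] at [x] with B_e = 1. *)
Definition topple (eta : config) (x : vertex G) (S : {set edge G}) : config :=
  [ffun y => if y == x then (eta x - #|S|)%N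
             else (eta y + #|S :&: edges_at y|)%N].

(* A rule selects the vertex to be toppled, given the current configuration and
   the list of the previous ones (most recent first). *)
Definition toppling_rule := config -> seq config -> vertex G.

Definition legal_rule (rule : toppling_rule) : Prop :=
  forall (xi : config) (past : seq config), ~~ stable xi ->
    (deg (rule xi past) < xi (rule xi past))%N.

Record orientation := Orientation {
  head_of :> edge G -> option (vertex G);
  head_ofP : forall e, head_of e \in ends e }.

Definition in_deg (O : orientation) (v : vertex G) : nat :=
  #|[set e | O e == Some v]%SET|.

Definition lacking (eta : config) (v : vertex G) : int :=
  (deg v)%:Z - (eta v)%:Z.

Definition compatible (O : orientation) (eta : config) : Prop :=
  forall v : vertex G, 1 + lacking eta v <= (in_deg O v)%:Z.

Definition comp_set (O : orientation) : set stable_config :=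
  [set eta | compatible O eta].

End Configurations.

Section MarkovChain.
Variables (R : realType) (S : finType) (P : S -> S -> R).

Fixpoint nstep (n : nat) (x y : S) : R :=
  if n is m.+1 then \sum_z P x z * nstep m z y else (x == y)%:R.

Definition accessible (x y : S) : Prop := exists n, 0 < nstep n x y.

Definition communicate (x y : S) : Prop := accessible x y /\ accessible y x.

(* Probability that the chain started at [x] visits [y] at time [n.+1] and at
   no earlier time in 1..n. *)
Fixpoint first_passage (n : nat) (x y : S) : R :=
  if n is m.+1 then \sum_(z | z != y) P x z * first_passage m z y else P x y.

Definition recurrent (x : S) : Prop :=
  series (fun n => first_passage n x x) @ \oo --> (1 : R).

Definition recurrent_class (x : S) : set S :=
  [set y | recurrent y /\ communicate x y].

End MarkovChain.

Section StochasticSandpile.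
Variables (R : realType) (G : sink_graph).
Variables (p : R) (rule : toppling_rule G) (mu : vertex G -> R).

Definition bernoulli_weight (x : vertex G) (S : {set edge G}) : R :=
  \prod_(e in edges_at x) (if e \in S then p else 1 - p).

(* Probability that, started from [xi] after [past], the topplings prescribed by
   [rule] reach a stable configuration in at most [n] steps, and that it is
   [zeta]. *)
Fixpoint stab_within (n : nat) (past : seq (config G)) (xi : config G)
    (zeta : stable_config G) : R :=
  if stable xi then (xi == config_of zeta)%:R
  else if n is m.+1 then
    let x := rule xi past in
    \sum_(S : {set edge G} | S \subset edges_at x)
      bernoulli_weight x S * stab_within m (xi :: past) (topple xi x S) zeta
  else 0.

Definition stab_law (xi : config G) (zeta : stable_config G) : R :=
  limn (fun n => stab_within n [::] xi zeta).

Definition transition (eta zeta : stable_config G) : R :=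
  \sum_v mu v * stab_law (add_grain eta v) zeta.

Definition Sto : set (stable_config G) :=
  recurrent_class transition (eta_max G).

End StochasticSandpile.

(* Main.v *)
(* A legal toppling of [x] along the set of edges [S] preserves compatibility
   once the edges of [S] are reoriented towards [x], so every configuration
   accessible from the maximal one is compatible with some orientation.

   Conversely, undoing a toppling of [v] along its incoming edges, and reversing
   these edges, keeps every charge in_O + eta and all grain numbers nonnegative.
   When no edge points to [v], a further grain can be pulled to [v] from its
   neighbour towards the sink. Hence a compatible configuration is reached by
   legal topplings from one that dominates the maximal configuration. Because
   distinct topplings commute, any legal sequence ending in a stable
   configuration can be rearranged so as to follow the given rule and the
   successive additions of grains: the configuration is accessible from the
   maximal one.

   Adding grains one by one makes the maximal configuration accessible from
   everywhere. Stabilization is almost sure, since sending single grains towards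
   the sink stabilizes within a number of steps bounded in terms of the total
   mass, so the chain is stochastic on a finite set and recurrence follows. *)
Require Import Defs.
From mathcomp Require Import all_boot all_order all_algebra.
From mathcomp Require Import all_classical all_reals all_analysis.
From mathcomp Require Import zify.

Local Open Scope classical_set_scope.
Local Open Scope ring_scope.

Set Implicit Arguments.
Unset Strict Implicit.
Unset Printing Implicit Defensive.

Import Order.TTheory GRing.Theory Num.Theory.
Import numFieldNormedType.Exports.

(** * Legal topplings and orientations *)

Section Topplings.
Variable G : sink_graph.
Implicit Types (xi eta zeta : config G) (x y v : vertex G).
Implicit Types (S T : {set edge G}) (O : orientation G).

(** Any unstable vertex may be toppled, whatever the rule prescribes. The index counts topplings and
    carries the induction in [legal_path_stab_within]. *)
Inductive legal_path : nat -> config G -> config G -> Prop :=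
| LegalNil xi : legal_path 0 xi xi
| LegalCons n xi x S zeta : (deg x < xi x)%N -> S \subset edges_at x ->
    legal_path n (topple xi x S) zeta -> legal_path n.+1 xi zeta.

Lemma legal_path_cat m n xi eta zeta :
  legal_path m xi eta -> legal_path n eta zeta -> legal_path (m + n) xi zeta.
Proof.
move=> h; elim: h n zeta => // k xi' x S eta' hx hS _ IH n zeta hn.
exact: LegalCons hx hS (IH _ _ hn).
Qed.

Lemma topple_self xi x S : topple xi x S x = (xi x - #|S|)%N.
Proof. by rewrite ffunE eqxx. Qed.

Lemma topple_other xi x S y : y != x ->
  topple xi x S y = (xi y + #|S :&: edges_at y|)%N.
Proof. by rewrite ffunE => /negbTE ->. Qed.

Lemma legal_card_le xi x S : (deg x < xi x)%N -> S \subset edges_at x ->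
  (#|S| <= xi x)%N.
Proof. by move=> hx /subset_leq_card hS; apply: leq_trans hS (ltnW hx). Qed.

(** The cardinality bounds keep the truncated subtractions exact, so grains received from the other
    toppling may arrive before or after. *)
Lemma topple_comm xi x y S T : x != y ->
  (#|S| <= xi x)%N -> (#|T| <= xi y)%N ->
  topple (topple xi x S) y T = topple (topple xi y T) x S.
Proof.
move=> xy hS hT; apply/ffunP => z.
case: (eqVneq z x) => [->|zx].
  by rewrite topple_self !(topple_other _ _ xy) topple_self addnBAC.
have yx : y != x by rewrite eq_sym.
case: (eqVneq z y) => [->|zy].
  by rewrite topple_self !(topple_other _ _ yx) topple_self addnBAC.
by rewrite !topple_other // addnAC.
Qed.

(* The unstable vertex [y] must be toppled before a stable configuration is
   reached, and its first toppling commutes with all the earlier ones. *)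
Lemma legal_path_pull n xi zeta y :
  legal_path n xi zeta -> stable zeta -> (deg y < xi y)%N ->
  exists2 m, n = m.+1 &
    exists2 T : {set edge G}, T \subset edges_at y & legal_path m (topple xi y T) zeta.
Proof.
move=> h; elim: h => {n xi zeta} [xi /forallP/(_ y) st|n xi x S zeta hx hS hp IH st] hy.
  by move: hy; rewrite ltnNge st.
case: (eqVneq x y) => [xy|xy]; first by rewrite -xy; exists n => //; exists S.
have yx : y != x by rewrite eq_sym.
case: IH => // [|m -> [T hT hp']].
  by rewrite topple_other //; apply: leq_trans hy _; apply: leq_addr.
exists m.+1 => //; exists T => //; apply: (LegalCons (x := x) (S := S)) => //.
  by rewrite topple_other //; apply: leq_trans hx _; apply: leq_addr.
by rewrite -topple_comm // legal_card_le.
Qed.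

Definition addc xi eta : config G := [ffun v => (xi v + eta v)%N].

Lemma topple_addc xi eta x S : (#|S| <= xi x)%N ->
  topple (addc xi eta) x S = addc (topple xi x S) eta.
Proof.
move=> hS; apply/ffunP => z; rewrite [RHS]ffunE.
case: (eqVneq z x) => [->|zx]; first by rewrite !topple_self ffunE addnBAC.
by rewrite !topple_other // ffunE addnAC.
Qed.

(** * Compatibility along legal topplings *)

Lemma compatibleP O eta :
  compatible O eta <-> forall v, (deg v < in_deg O v + eta v)%N.
Proof. by split=> h v; move: (h v); rewrite /lacking; lia. Qed.

Lemma in_deg_le O v : (in_deg O v <= deg v)%N.
Proof.
apply/subset_leq_card/fintype.subsetP => e; rewrite !inE => /eqP <-.
exact: head_ofP.
Qed.

Fact reorient_subproof O x S e :
  (if e \in S :&: edges_at x then Some x else O e) \in ends e.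
Proof. by case: ifP => [|_]; [rewrite !inE => /andP[] | exact: head_ofP]. Qed.

Definition reorient O x S := Orientation (reorient_subproof O x S).

(** At [x], the edges of [S] now point inwards and make up for the grains sent, so the sum stays at
    least [xi x]. Another vertex loses at most one incoming edge per grain received. *)
Lemma compatible_topple O xi x S : compatible O xi ->
  (deg x < xi x)%N -> S \subset edges_at x ->
  compatible (reorient O x S) (topple xi x S).
Proof.
move=> /compatibleP cO hx hS; apply/compatibleP => y.
case: (eqVneq y x) => [->|yx].
  have : (#|S| <= in_deg (reorient O x S) x)%N.
    apply/subset_leq_card/fintype.subsetP => e eS.
    by rewrite !inE /= finset.inE eS (fintype.subsetP hS _ eS).
  by have := legal_card_le hx hS; rewrite topple_self; lia.
have : (in_deg O y <= in_deg (reorient O x S) y + #|S :&: edges_at y|)%N.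
  apply: leq_trans (leq_card_setU _ _).
  apply/subset_leq_card/fintype.subsetP => e; rewrite !inE /= => /eqP Oe.
  have -> : Some y \in ends e by rewrite -Oe; exact: head_ofP.
  by rewrite !inE; case: (e \in S) => //=; rewrite ?orbT // Oe eqxx.
by rewrite topple_other //; have := cO y; lia.
Qed.

Lemma compatible_legal_path n xi zeta : legal_path n xi zeta ->
  (exists O, compatible O xi) -> exists O, compatible O zeta.
Proof.
move=> h; elim: h => {n xi zeta} // n xi x S zeta hx hS _ IH [ O cO].
by apply: IH; exists (reorient O x S); exact: compatible_topple.
Qed.

(** * Reversing edges and undoing topplings *)

Lemma other_end (e : edge G) (a : option (vertex G)) : a \in ends e ->
  exists2 b, b != a & ends e = [set a; b]%SET.
Proof.
move=> ae; have := cardsD1 a (ends e); rewrite ae card_ends add1n => -[].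
move=> /esym/eqP/cards1P[b eb]; exists b.
  by have := finset.set11 b; rewrite -eb !inE => /andP[].
by rewrite -[LHS](finset.setD1K ae) eb.
Qed.

Definition away (e : edge G) (a : option (vertex G)) : option (vertex G) :=
  odflt a [pick b in ends e | b != a].

Lemma awayE e a b : b != a -> ends e = [set a; b]%SET -> away e a = b.
Proof.
move=> ba ee; rewrite /away; case: pickP => [c|/(_ b)] /=.
  by rewrite ee !inE => /andP[/orP[/eqP ->|/eqP //]]; rewrite eqxx.
by rewrite ee !inE eqxx ba orbT.
Qed.

Definition in_edges O v : {set edge G} := [set e | O e == Some v]%SET.

Fact unhead_subproof O v e :
  (if O e == Some v then away e (Some v) else O e) \in ends e.
Proof.
case: ifP => [/eqP Oe|_]; last exact: head_ofP.
have ve : Some v \in ends e by rewrite -Oe head_ofP.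
by have [b bv ee] := other_end ve; rewrite (awayE bv ee) ee !inE eqxx orbT.
Qed.

Definition unhead O v := Orientation (unhead_subproof O v).

Lemma away_neq e a : a \in ends e -> away e a != a.
Proof. by move=> /other_end[b ba ee]; rewrite (awayE ba ee). Qed.

Lemma in_deg_unhead_self O v : in_deg (unhead O v) v = 0%N.
Proof.
apply/eqP; rewrite cards_eq0; apply/eqP/finset.setP => e; rewrite !inE /=.
case: ifP => // /eqP Oe; apply/negbTE/away_neq.
by rewrite -Oe head_ofP.
Qed.

(** The edges pointing to [y] and those joining [y] to [v] and pointing to [v] are disjoint sets of
    edges at [y]. Under compatibility, [y] thus holds enough grains to give one back along each of
    the latter. *)
Lemma in_edgesI_card O v y : y != v ->
  (in_deg O y + #|in_edges O v :&: edges_at y| <= deg y)%N.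
Proof.
move=> yv; rewrite -cardsUI [X in (_ + X)%N](_ : _ = 0%N) ?addn0.
  apply/subset_leq_card/fintype.subsetP => e; rewrite !inE.
  by case/orP => [/eqP <-|/andP[]//]; exact: head_ofP.
apply/eqP; rewrite cards_eq0; apply/eqP/finset.setP => e; rewrite !inE.
by case: eqP => //= ->; rewrite (inj_eq (@Some_inj _)) (negbTE yv).
Qed.

Lemma in_deg_unhead O v y : y != v ->
  (in_deg O y + #|in_edges O v :&: edges_at y| <= in_deg (unhead O v) y)%N.
Proof.
move=> yv; rewrite -cardsUI [X in (_ + X)%N](_ : _ = 0%N) ?addn0.
  apply/subset_leq_card/fintype.subsetP => e; rewrite !inE /=.
  case/orP => [/eqP ->|/andP[/eqP Oe ye]].
    by rewrite (inj_eq (@Some_inj _)) (negbTE yv).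
  rewrite Oe eqxx; apply/eqP.
  have [b bv ee] : exists2 b, b != Some v & ends e = [set Some v; b]%SET.
    by apply: other_end; rewrite -Oe head_ofP.
  rewrite (awayE bv ee); move: ye; rewrite ee !inE.
  by rewrite (inj_eq (@Some_inj _)) (negbTE yv) /= => /eqP.
apply/eqP; rewrite cards_eq0; apply/eqP/finset.setP => e; rewrite !inE.
by case: eqP => //= ->; rewrite (inj_eq (@Some_inj _)) (negbTE yv).
Qed.

(* Compatibility of [eta] with [O] means that the charge of each [v] exceeds
   [deg v]; it is this quantity that untoppling preserves. *)
Definition charge O eta v : nat := (in_deg O v + eta v)%N.

Definition untopple eta v S : config G :=
  [ffun y => if y == v then (eta y + #|S|)%N
             else (eta y - #|S :&: edges_at y|)%N].

Lemma untoppleK eta v S :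
  (forall y, y != v -> (#|S :&: edges_at y| <= eta y)%N) ->
  topple (untopple eta v S) v S = eta.
Proof.
move=> h; apply/ffunP => y; case: (eqVneq y v) => [->|yv].
  by rewrite topple_self ffunE eqxx addnK.
by rewrite topple_other // ffunE (negbTE yv) subnK // h.
Qed.

Lemma untopple_legal_path eta v S : S \subset edges_at v ->
  (deg v < eta v + #|S|)%N ->
  (forall y, y != v -> (#|S :&: edges_at y| <= eta y)%N) ->
  legal_path 1 (untopple eta v S) eta.
Proof.
move=> hS hv hy; apply: (LegalCons (x := v) (S := S)) => //.
  by rewrite ffunE eqxx.
by rewrite untoppleK //; exact: LegalNil.
Qed.

(** Each edge pointing to [v] is traded for a grain at [v], while a neighbour pays one grain and
    gains the reversed edge. The undone toppling is legal precisely because the charge of [v]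
    exceeds [deg v]. *)
Lemma clear_in_edges O eta v : compatible O eta ->
  exists O' eta' n, [/\ compatible O' eta', legal_path n eta' eta,
    in_deg O' v = 0%N & forall y, (charge O eta y <= charge O' eta' y)%N].
Proof.
move=> /compatibleP cO.
have hc y : (charge O eta y <= charge (unhead O v) (untopple eta v (in_edges O v)) y)%N.
  rewrite /charge ffunE; case: (eqVneq y v) => [->|yv].
    by rewrite in_deg_unhead_self addnC.
  have := in_deg_unhead O yv; have := in_edgesI_card O yv.
  by have := cO y; lia.
exists (unhead O v), (untopple eta v (in_edges O v)), 1%N; split => //.
- by apply/compatibleP => y; apply: leq_trans (cO y) (hc y).
- apply: untopple_legal_path.
  + by apply/fintype.subsetP => e; rewrite !inE => /eqP <-; exact: head_ofP.
  + by rewrite addnC cO.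
  + by move=> y yv; have := in_edgesI_card O yv; have := cO y; lia.
- exact: in_deg_unhead_self.
Qed.

Lemma card_set1I (e : edge G) S : #|[set e]%SET :&: S| = (e \in S).
Proof.
case: (boolP (e \in S)) => eS.
  by rewrite (finset.setIidPl _) ?cards1 // finset.sub1set.
apply/eqP; rewrite cards_eq0; apply/eqP/finset.setP => f; rewrite !inE.
by apply/negbTE/andP => -[/eqP -> ]; exact/negP.
Qed.

(** Since no edge points to [v], compatibility alone gives more than [deg v] grains there, so a
    toppling along the single edge [e] can be undone. The charge of [b] drops by one unless [b] is
    the sink, so compatibility of the result is not claimed. *)
Lemma pull_grain O eta v e b : compatible O eta ->
  in_deg O v = 0%N -> b != Some v -> ends e = [set Some v; b]%SET ->
  exists eta' n, legal_path n eta' eta /\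
    forall y, (charge O eta y + (y == v) <= charge O eta' y + (Some y == b))%N.
Proof.
move=> /compatibleP cO inv bv ee.
have eat y : y != v -> (e \in edges_at y) = (Some y == b).
  by move=> yv; rewrite !inE ee !inE (inj_eq (@Some_inj _)) (negbTE yv).
exists (untopple eta v [set e]%SET), 1%N; split.
  apply: untopple_legal_path.
  - by rewrite finset.sub1set inE ee !inE eqxx.
  - by rewrite cards1 addn1; apply: leq_trans (cO v) _; rewrite inv leqW.
  - move=> y yv; rewrite card_set1I; have := cO y; have := in_deg_le O y.
    by case: (e \in _); lia.
move=> y; rewrite /charge ffunE; case: (eqVneq y v) => [->|yv].
  by rewrite cards1; lia.
by rewrite card_set1I eat //; case: eqP => _; lia.
Qed.

(** * Raising charges with grains drawn from the sink *)

Definition distance_to_sink (d : option (vertex G) -> nat) := forall v,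
  exists e b, ends e = [set Some v; b]%SET /\ (d b < d (Some v))%N.

(** The least length of a path to the sink works: the tail of a shortest path from [v] starts at a
    neighbour and is one step shorter. *)
Lemma distance_to_sink_exists : connected_graph G ->
  exists d, distance_to_sink d.
Proof.
move=> conn.
pose has_path a n := `[< exists p, [/\ path (@adj_vertex G) a p,
  last a p = None & size p = n] >].
have ex a : exists n, has_path a n.
  have /connectP[p hp lp] := conn a None.
  by exists (size p); apply/asboolP; exists p.
exists (fun a => ex_minn (ex a)) => v.
case: (ex_minnP (ex (Some v))) => m /asboolP[[|b p] [//=]].
move=> /andP[/existsP[e /eqP ee] hp] lp <- _.
exists e, b; split => //; case: ex_minnP => k _; apply.
by apply/asboolP; exists p.
Qed.

Section Distance.
Variable d : option (vertex G) -> nat.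
Hypothesis dP : distance_to_sink d.

(** Induction on the distance to the sink: the neighbour [b] first gains the unit of charge that [v]
    then takes from it. The sink gives for free. *)
Lemma raise_charge O eta v : compatible O eta ->
  exists O' eta' n, [/\ compatible O' eta', legal_path n eta' eta &
    forall y, (charge O eta y + (y == v) <= charge O' eta' y)%N].
Proof.
have [k] := ubnP (d (Some v)); elim: k => // k IH in v O eta * => dv cO.
have [e [b [ee db]]] := dP v.
have bv : b != Some v by apply: contraTneq db => ->; rewrite ltnn.
have [ O1 [eta1 [n1 [c1 p1 h1]]]] : exists O' eta' n,
    [/\ compatible O' eta', legal_path n eta' eta &
    forall y, (charge O eta y + (Some y == b) <= charge O' eta' y)%N].
  case: b db {ee bv} => [w|] db; first by apply: IH => //; lia.
  exists O, eta, 0%N; split => //; first exact: LegalNil.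
  by move=> y; rewrite addn0.
(* Raising [b] may have changed the orientation, so the edges pointing to [v] are cleared only now,
   just before the pull. *)
have [ O2 [eta2 [n2 [c2 p2 in2 h2]]]] := clear_in_edges v c1.
have [eta3 [n3 [p3 h3]]] := pull_grain c2 in2 bv ee.
have h y : (charge O eta y + (y == v) <= charge O2 eta3 y)%N.
  by have := h1 y; have := h2 y; have := h3 y; lia.
exists O2, eta3, (n3 + (n2 + n1))%N; split => //.
  apply/compatibleP => y; move/compatibleP: cO => /(_ y).
  by have := h y; rewrite /charge; lia.
exact: legal_path_cat p3 (legal_path_cat p2 p1).
Qed.

Lemma raise_charges O eta (l : seq (vertex G)) : compatible O eta ->
  exists O' eta' n, [/\ compatible O' eta', legal_path n eta' eta &
    forall y, (charge O eta y + count_mem y l <= charge O' eta' y)%N].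
Proof.
move=> cO; elim: l => [|v l [ O1 [eta1 [n1 [c1 p1 h1]]]]].
  exists O, eta, 0%N; split => //; first exact: LegalNil.
  by move=> y; rewrite addn0.
have [ O2 [eta2 [n2 [c2 p2 h2]]]] := raise_charge v c1.
exists O2, eta2, (n2 + n1)%N; split => //; first exact: legal_path_cat p2 p1.
move=> y /=; rewrite (eq_sym v y) addnCA addnC; apply: leq_trans (h2 y).
by rewrite leq_add2r.
Qed.

Lemma raise_charge_all O eta N : compatible O eta ->
  exists O' eta' n, [/\ compatible O' eta', legal_path n eta' eta &
    forall y, (charge O eta y + N <= charge O' eta' y)%N].
Proof.
move=> cO; elim: N => [|N [ O1 [eta1 [n1 [c1 p1 h1]]]]].
  exists O, eta, 0%N; split => //; first exact: LegalNil.
  by move=> y; rewrite addn0.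
have [ O2 [eta2 [n2 [c2 p2 h2]]]] := raise_charges (enum (vertex G)) c1.
exists O2, eta2, (n2 + n1)%N; split => //; first exact: legal_path_cat p2 p1.
move=> y /=; have := h1 y; have := h2 y.
by rewrite count_uniq_mem ?enum_uniq // mem_enum /=; lia.
Qed.

Lemma compatible_legal_path_from_above O eta : compatible O eta ->
  exists delta n, legal_path n (addc (eta_max G) delta) eta.
Proof.
(* As [#|edge G|] bounds every [in_deg O' y], a charge above [deg y + #|edge G|] leaves at least
   [deg y] grains at [y]. *)
move=> cO; have [ O' [eta' [n [_ p' h]]]] := raise_charge_all #|edge G| cO.
exists [ffun y => (eta' y - deg y)%N], n.
suff -> : addc (eta_max G) [ffun y => (eta' y - deg y)%N] = eta' by [].
apply/ffunP => y; rewrite !ffunE subnKC //.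
have := h y; rewrite /charge; move/compatibleP: cO => /(_ y).
have : (in_deg O' y <= #|edge G|)%N by exact: max_card.
lia.
Qed.

(* Orient every edge towards its endpoint farthest from the sink. *)
Lemma compatible_eta_max : exists O, compatible O (eta_max G).
Proof.
have ex (e : edge G) : exists a,
    a \in ends e /\ forall b, b \in ends e -> (d b <= d a)%N.
  have : (0 < #|ends e|)%N by rewrite card_ends.
  case/card_gt0P => i0 hi0.
  by case: (@arg_maxnP _ i0 (fun a => a \in ends e) d hi0) => a ha hmax; exists a.
pose O := Orientation (fun e => proj1 (projT2 (cid (ex e)))).
exists O; apply/compatibleP => v; rewrite !ffunE -add1n leq_add2r.
have [e [b [ee db]]] := dP v.
apply/card_gt0P; exists e; rewrite inE /=.
case: (cid (ex e)) => a /= [ha /(_ (Some v))]; rewrite ee !inE eqxx => /(_ isT).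
move: ha; rewrite ee !inE => /orP[//|/eqP ->].
by rewrite leqNgt db.
Qed.

Definition potential xi : nat := (\sum_v xi v * d (Some v))%N.

Definition mass xi : nat := (\sum_v xi v)%N.

End Distance.
End Topplings.

(** * Recurrence in finite Markov chains *)

Section FiniteChain.
Variables (R : realType) (S : finType) (P : S -> S -> R).
Hypothesis P_ge0 : forall x y, 0 <= P x y.

Lemma nstep_ge0 n x y : 0 <= nstep P n x y.
Proof.
elim: n x => [|n IH] x /=; first by rewrite ler0n.
by apply: sumr_ge0 => z _; rewrite mulr_ge0.
Qed.

Lemma accessible_refl x : accessible P x x.
Proof. by exists 0%N; rewrite /= eqxx ltr01. Qed.

Lemma accessible_step x y z : 0 < P x y -> accessible P y z ->
  accessible P x z.
Proof.
move=> xy [n yz]; exists n.+1; rewrite /= (bigD1 y) //=.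
apply: ltr_pwDl; first exact: mulr_gt0.
by apply: sumr_ge0 => t _; rewrite mulr_ge0 // nstep_ge0.
Qed.

Lemma nstepS_gt0 n x y : 0 < nstep P n.+1 x y ->
  exists2 z, 0 < P x z & 0 < nstep P n z y.
Proof.
move=> /= /lt0r_neq0/eqP h.
case: (psumr_neq0P _ h) => [z _|z /andP[_ hz]].
  by rewrite mulr_ge0 // nstep_ge0.
exists z; rewrite lt0r ?P_ge0 ?nstep_ge0 andbT.
  by apply: contraTneq hz => ->; rewrite mul0r ltxx.
by apply: contraTneq hz => ->; rewrite mulr0 ltxx.
Qed.

Lemma accessible_trans x y z : accessible P x y -> accessible P y z ->
  accessible P x z.
Proof.
move=> [n] + yz; elim: n x => [|n IH] x.
  by rewrite /=; case: eqP => [->|_]; rewrite ?ltxx.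
by move=> /nstepS_gt0[t xt ty]; apply: accessible_step xt (IH _ ty).
Qed.

Lemma first_passage_ge0 n x y : 0 <= first_passage P n x y.
Proof.
elim: n x => [|n IH] x //=.
by apply: sumr_ge0 => z _; rewrite mulr_ge0.
Qed.

Hypothesis P_sum1 : forall x, \sum_y P x y = 1.

(** * Return to a state accessible from everywhere *)

Section Target.
Variable x : S.
Hypothesis x_acc : forall y, accessible P y x.

Lemma first_passage_step_gt0 y z n : z != x -> 0 < P y z ->
  0 < first_passage P n z x -> 0 < first_passage P n.+1 y x.
Proof.
move=> zx yz hz; rewrite /= (bigD1 z) //=.
apply: ltr_pwDl; first exact: mulr_gt0.
by apply: sumr_ge0 => t _; rewrite mulr_ge0 // first_passage_ge0.
Qed.

(** A path of positive probability is cut at its first visit to [x]. *)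
Lemma nstep_first_passage n y : 0 < nstep P n y x -> y != x ->
  exists k, 0 < first_passage P k y x.
Proof.
elim: n y => [|n IH] y; first by rewrite /=; case: eqP; rewrite ?ltxx.
move=> /nstepS_gt0[z yz hz] _; case: (eqVneq z x) => [zx|zx].
  by exists 0%N; rewrite /= -zx.
have [k hk] := IH z hz zx.
by exists k.+1; exact: first_passage_step_gt0 hk.
Qed.

Lemma first_passage_gt0 y : exists k, 0 < first_passage P k y x.
Proof.
have [n hn] := x_acc y.
have [yx|yx] := eqVneq y x; last exact: nstep_first_passage hn yx.
(* Starting from [x], the given path may be empty whereas a return takes at least one step; a first
   step exists because the row sums to 1. *)
have [z _ yz] : exists2 z, true & 0 < P y z.
  have [//|z /andP[_ yz]] := @psumr_neq0P _ _ predT (P y) (fun z _ => P_ge0 y z).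
    by rewrite P_sum1; apply/eqP; rewrite oner_eq0.
  by exists z.
have [zx|zx] := eqVneq z x; first by exists 0%N; rewrite /= -zx.
have [m hm] := x_acc z; have [k hk] := nstep_first_passage hm zx.
by exists k.+1; exact: first_passage_step_gt0 hk.
Qed.

(** The probability of not visiting [x] at times 1 to [n], since [first_passage k] refers to time
    [k.+1]. *)
Definition avoid n y : R := 1 - series (fun k => first_passage P k y x) n.

Lemma avoid0 y : avoid 0 y = 1.
Proof. by rewrite /avoid /series /= big_nil subr0. Qed.

Lemma avoidS n y : avoid n.+1 y = \sum_(z | z != x) P y z * avoid n z.
Proof.
rewrite /avoid /series /= big_nat_recl //= opprD addrA.
have -> : 1 - P y x = \sum_(z | z != x) P y z.
  by rewrite -(P_sum1 y) (bigD1 x) //= addrAC subrr add0r.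
under [X in _ - X]eq_bigr do rewrite /=.
rewrite exchange_big -sumrB; apply: eq_bigr => z _.
by rewrite mulrBr mulr1 mulr_sumr.
Qed.

Lemma avoid_ge0 n y : 0 <= avoid n y.
Proof.
elim: n y => [|n IH] y; first by rewrite avoid0 ler01.
by rewrite avoidS; apply: sumr_ge0 => z _; rewrite mulr_ge0.
Qed.

Lemma avoid_nonincreasing m n y : (m <= n)%N -> avoid n y <= avoid m y.
Proof.
move=> /subnK <-; elim: (n - m)%N => // k IH; apply: le_trans IH.
rewrite addSn /avoid /series /= big_nat_recr //= lerD2l lerN2 lerDl.
exact: first_passage_ge0.
Qed.

(** Finiteness of [S] allows a common horizon [N], the maximum of the individual ones, because
    [avoid] decreases with time. *)
Lemma avoid_lt1 : exists N b, [/\ 0 <= b, b < 1 & forall y, avoid N y <= b].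
Proof.
have hk y : exists k, avoid k y < 1.
  have [k hk] := first_passage_gt0 y; exists k.+1.
  rewrite /avoid /series /= big_nat_recr //= gtrBl ltr_wpDl //.
  by apply: sumr_ge0 => i _; exact: first_passage_ge0.
pose N := (\max_y sval (cid (hk y)))%N.
have hN y : avoid N y < 1.
  by apply: le_lt_trans (svalP (cid (hk y))); apply: avoid_nonincreasing; exact: leq_bigmax.
exists N, (\big[Order.max/0]_y avoid N y); split.
- by apply: (big_ind (fun z => 0 <= z)) => // [a b a0 _|y _]; rewrite ?le_max ?a0 ?avoid_ge0.
- by apply: (big_ind (fun z => z < 1)) => // a b a1 b1; rewrite gt_max a1.
- by move=> y; apply: le_bigmax_cond.
Qed.

(** Markov property at time [m]: wherever the chain then is, avoiding [x] for [n] more steps costs a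
    factor at most [b]. *)
Lemma avoidD m n b y : (forall z, avoid n z <= b) ->
  avoid (m + n) y <= avoid m y * b.
Proof.
move=> hb; elim: m y => [|m IH] y; first by rewrite avoid0 mul1r.
rewrite addSn !avoidS mulr_suml; apply: ler_sum => z _.
by rewrite -mulrA ler_wpM2l.
Qed.

(** Avoiding [x] during [j * N] steps has probability at most [b ^+ j], which tends to 0. *)
Lemma accessible_recurrent : recurrent P x.
Proof.
have [N [b [b0 b1 hb]]] := avoid_lt1.
have hj j : avoid (j * N) x <= b ^+ j.
  elim: j => [|j IH]; first by rewrite avoid0.
  rewrite mulSn addnC exprSr; apply: le_trans (avoidD _ _ hb) _.
  by rewrite ler_wpM2r.
have ub n : series (fun k => first_passage P k x x) n <= 1.
  by have := avoid_ge0 n x; rewrite subr_ge0.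
have nd : nondecreasing_seq (series (fun k => first_passage P k x x)).
  by move=> m n mn; have := avoid_nonincreasing x mn; rewrite lerD2l lerN2.
have cv : cvgn (series (fun k => first_passage P k x x)).
  by apply: nondecreasing_is_cvgn => //; exists 1 => _ [n _ <-].
suff e : 1 = limn (series (fun k => first_passage P k x x)) :> R.
  by rewrite /recurrent e.
apply/eqP; rewrite eq_le andbC; apply/andP; split.
  by apply: limr_le => //; apply: nearW => n; exact: ub.
rewrite -subr_le0.
have bcv : (GRing.exp b : R ^nat) @ \oo --> (0 : R).
  by apply: cvg_expr; rewrite ger0_norm.
rewrite -(cvg_lim _ bcv) //; apply: limr_ge; first by apply/cvg_ex; exists 0.
apply: nearW => j; apply: le_trans (hj j).
by rewrite lerD2l lerN2; exact: nondecreasing_cvgn_le.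
Qed.

End Target.
End FiniteChain.

(** * Almost sure stabilization *)

Section Decrease.
Variable G : sink_graph.
Implicit Types (xi : config G) (x : vertex G) (S : {set edge G}).

(** Each edge of [S] has at most one endpoint in V other than [x]; grains sent to the sink are
    lost. *)
Lemma mass_topple xi x S : (#|S| <= xi x)%N -> S \subset edges_at x ->
  (mass (topple xi x S) <= mass xi)%N.
Proof.
move=> hS Sx; rewrite /mass (bigD1 x) //= [leqRHS](bigD1 x) //=.
rewrite topple_self (eq_bigr _ (fun y yx => topple_other xi S yx)) big_split /=.
have : (\sum_(y | y != x) #|S :&: edges_at y| <= #|S|)%N; last lia.
rewrite (eq_bigr (fun y => \sum_(e in S) (e \in edges_at y))%N); last first.
  move=> y _; rewrite -sum1_card (eq_bigl (fun e => (e \in S) && (e \in edges_at y))).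
    by rewrite big_mkcondr.
  by move=> e; rewrite inE.
rewrite exchange_big -sum1_card leq_sum //= => e eS.
have := fintype.subsetP Sx _ eS; rewrite inE => /other_end[b bx ee].
rewrite (eq_bigr (fun y => (Some y == b) : nat)); last first.
  by move=> y yx; rewrite inE ee !inE (inj_eq (@Some_inj _)) (negbTE yx).
case: b {ee bx} => [w|]; last by rewrite big1.
rewrite big_mkcond (bigD1 w) //= big1 ?addn0; first by case: ifP => // _; exact: leq_b1.
by move=> y yw; rewrite (inj_eq (@Some_inj _)) (negbTE yw) if_same.
Qed.

Variable d : option (vertex G) -> nat.

Lemma potential_topple xi x e b : (0 < xi x)%N ->
  ends e = [set Some x; b]%SET -> (d b < d (Some x))%N ->
  (potential d (topple xi x [set e]%SET) < potential d xi)%N.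
Proof.
move=> x0 ee db; rewrite /potential (bigD1 x) //= [ltnRHS](bigD1 x) //=.
rewrite topple_self cards1.
rewrite (eq_bigr (fun y => xi y * d (Some y) + (Some y == b) * d (Some y)))%N; last first.
  move=> y yx; rewrite topple_other // card_set1I inE ee !inE.
  by rewrite (inj_eq (@Some_inj _)) (negbTE yx) mulnDl.
rewrite big_split /=.
have : (\sum_(y | y != x) (Some y == b) * d (Some y) <= d b)%N.
  case: b {ee db} => [w|]; last by rewrite big1.
  rewrite big_mkcond (bigD1 w) //= big1 ?addn0.
    by case: ifP => // _; rewrite eqxx mul1n.
  by move=> y yw; rewrite (inj_eq (@Some_inj _)) (negbTE yw) if_same.
have -> : (xi x * d (Some x) = (xi x - 1) * d (Some x) + d (Some x))%N.
  by rewrite -mulSnr subn1 prednK.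
lia.
Qed.

Definition max_depth := (\sum_v d (Some v))%N.

(** As legal topplings never increase the mass, this bounds the potential uniformly throughout a
    stabilization. *)
Lemma potential_le_mass xi : (potential d xi <= mass xi * max_depth)%N.
Proof.
rewrite /potential /mass big_distrl /=; apply: leq_sum => v _.
by rewrite leq_mul // /max_depth (bigD1 v) //= leq_addr.
Qed.

End Decrease.

(** * The law of the stabilized configuration *)

Section Stabilization.
Variables (R : realType) (G : sink_graph) (p : R) (rule : toppling_rule G).
Hypotheses (p_gt0 : 0 < p) (p_lt1 : p < 1) (rule_legal : legal_rule rule).
Implicit Types (xi : config G) (eta zeta : stable_config G) (x : vertex G).
Implicit Types (S : {set edge G}) (past : seq (config G)).

Lemma bernoulli_weight_gt0 x S : 0 < bernoulli_weight p x S.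
Proof. by apply: prodr_gt0 => e _; case: ifP => _ //; rewrite subr_gt0. Qed.

Lemma sum_bernoulli_weight x :
  \sum_(S : {set edge G} | S \subset edges_at x) bernoulli_weight p x S = 1.
Proof.
(* The product of the factors p + (1 - p) is expanded over subsets; the values 0 and 1 outside
   [edges_at x] kill the subsets not contained in it. *)
pose F e : R := if e \in edges_at x then p else 0.
pose F' e : R := if e \in edges_at x then 1 - p else 1.
transitivity (\prod_e (F e + F' e)); last first.
  by rewrite big1 // => e _; rewrite /F /F'; case: ifP => _; rewrite ?add0r // addrC subrK.
rewrite bigA_distr big_mkcond; apply: eq_bigr => S _.
case: ifPn => [Sx|/subsetPn[e eS ex]].
  rewrite /bernoulli_weight big_mkcond; apply: eq_bigr => e _; rewrite /F /F'.
  have [eS|] := boolP (e \in S); first by rewrite (fintype.subsetP Sx _ eS).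
  by case: ifP.
by rewrite (bigD1 e) //= eS /F (negbTE ex) mul0r.
Qed.

(** [p * (1 - p)] lies below both [p] and [1 - p]; one factor per edge of the whole graph makes the
    bound independent of the vertex. *)
Definition weight_bound : R := (p * (1 - p)) ^+ #|edge G|.

Lemma weight_bound_gt0 : 0 < weight_bound.
Proof. by rewrite exprn_gt0 // mulr_gt0 // subr_gt0. Qed.

Lemma bernoulli_weight_ge x S : weight_bound <= bernoulli_weight p x S.
Proof.
have q0 : 0 <= p * (1 - p) by rewrite mulr_ge0 ?subr_ge0 // ltW.
have q1 : p * (1 - p) <= 1.
  by rewrite mulr_ile1 ?subr_ge0 ?lerBlDr ?lerDl // ltW.
apply: (@le_trans _ _ ((p * (1 - p)) ^+ #|edges_at x|)).
  by rewrite ler_wiXn2l // max_card.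
rewrite -prodr_const; apply: ler_prod => e _; rewrite q0 /=.
by case: ifP => _; [rewrite ler_piMr | rewrite ler_piMl];
  rewrite ?subr_ge0 ?lerBlDr ?lerDl // ltW.
Qed.

Lemma stab_within_stable n past xi zeta : stable xi ->
  stab_within p rule n past xi zeta = (xi == config_of zeta)%:R.
Proof. by case: n => [|n] /= ->. Qed.

Lemma stab_within0 past xi zeta : ~~ stable xi ->
  stab_within p rule 0 past xi zeta = 0.
Proof. by move=> /= /negbTE ->. Qed.

Lemma stab_withinS n past xi zeta : ~~ stable xi ->
  stab_within p rule n.+1 past xi zeta =
  \sum_(S : {set edge G} | S \subset edges_at (rule xi past))
    bernoulli_weight p (rule xi past) S *
    stab_within p rule n (xi :: past) (topple xi (rule xi past) S) zeta.
Proof. by move=> /= /negbTE ->. Qed.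

Lemma stab_within_ge0 n past xi zeta : 0 <= stab_within p rule n past xi zeta.
Proof.
elim: n past xi => [|n IH] past xi; have [st|st] := boolP (stable xi).
- by rewrite stab_within_stable.
- by rewrite stab_within0.
- by rewrite stab_within_stable.
rewrite stab_withinS //; apply: sumr_ge0 => S _.
by rewrite mulr_ge0 // ltW // bernoulli_weight_gt0.
Qed.

Lemma stab_within_nondecreasing past xi zeta :
  nondecreasing_seq (fun n => stab_within p rule n past xi zeta).
Proof.
apply/nondecreasing_seqP => n; elim: n past xi => [|n IH] past xi.
  have [st|st] := boolP (stable xi); first by rewrite !stab_within_stable.
  by rewrite stab_within0 // stab_within_ge0.
have [st|st] := boolP (stable xi); first by rewrite !stab_within_stable.
rewrite !(stab_withinS _ _ _ st); apply: ler_sum => S _.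
by rewrite ler_wpM2l // ltW // bernoulli_weight_gt0.
Qed.

Definition stab_mass n past xi : R := \sum_zeta stab_within p rule n past xi zeta.

Lemma stab_mass_stable n past xi : stable xi -> stab_mass n past xi = 1.
Proof.
move=> st; rewrite /stab_mass (bigD1 (StableConfig st)) //=.
rewrite stab_within_stable //= eqxx big1 ?addr0 // => zeta hz.
rewrite stab_within_stable // -[xi]/(val (StableConfig st)).
by rewrite (inj_eq val_inj) eq_sym (negbTE hz).
Qed.

Lemma stab_mass0 past xi : ~~ stable xi -> stab_mass 0 past xi = 0.
Proof. by move=> st; rewrite /stab_mass big1 // => zeta _; rewrite stab_within0. Qed.

Lemma stab_massS n past xi : ~~ stable xi ->
  stab_mass n.+1 past xi =
  \sum_(S : {set edge G} | S \subset edges_at (rule xi past))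
    bernoulli_weight p (rule xi past) S *
    stab_mass n (xi :: past) (topple xi (rule xi past) S).
Proof.
move=> st; rewrite /stab_mass (eq_bigr _ (fun zeta _ => stab_withinS n past zeta st)).
by rewrite exchange_big; apply: eq_bigr => S _; rewrite mulr_sumr.
Qed.

Lemma stab_mass_ge0 n past xi : 0 <= stab_mass n past xi.
Proof. by apply: sumr_ge0 => zeta _; exact: stab_within_ge0. Qed.

Lemma stab_mass_failS n past xi : ~~ stable xi ->
  1 - stab_mass n.+1 past xi =
  \sum_(S : {set edge G} | S \subset edges_at (rule xi past))
    bernoulli_weight p (rule xi past) S *
    (1 - stab_mass n (xi :: past) (topple xi (rule xi past) S)).
Proof.
move=> st; rewrite stab_massS // -{1}(sum_bernoulli_weight (rule xi past)).
by rewrite -sumrB; apply: eq_bigr => S _; rewrite mulrBr mulr1.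
Qed.

Lemma stab_mass_le1 n past xi : stab_mass n past xi <= 1.
Proof.
elim: n past xi => [|n IH] past xi; have [st|st] := boolP (stable xi).
- by rewrite stab_mass_stable.
- by rewrite stab_mass0.
- by rewrite stab_mass_stable.
rewrite -subr_ge0 stab_mass_failS //; apply: sumr_ge0 => S _.
by rewrite mulr_ge0 ?subr_ge0 // ltW // bernoulli_weight_gt0.
Qed.

Lemma stab_within_le1 n past xi zeta : stab_within p rule n past xi zeta <= 1.
Proof.
apply: le_trans (stab_mass_le1 n past xi).
rewrite /stab_mass (bigD1 zeta) //= lerDl; apply: sumr_ge0 => z _.
exact: stab_within_ge0.
Qed.

Lemma stab_law_cvg xi zeta :
  (fun n => stab_within p rule n [::] xi zeta) @ \oo --> stab_law p rule xi zeta.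
Proof.
apply: nondecreasing_is_cvgn; first exact: stab_within_nondecreasing.
by exists 1 => _ [n _ <-]; exact: stab_within_le1.
Qed.

Lemma stab_within_le_law n xi zeta :
  stab_within p rule n [::] xi zeta <= stab_law p rule xi zeta.
Proof.
apply: nondecreasing_cvgn_le; first exact: stab_within_nondecreasing.
by apply/cvg_ex; exists (stab_law p rule xi zeta); exact: stab_law_cvg.
Qed.

Lemma stab_law_ge0 xi zeta : 0 <= stab_law p rule xi zeta.
Proof. exact: le_trans (stab_within_ge0 0 _ _ _) (stab_within_le_law 0 _ _). Qed.

Lemma stab_law_gt0 xi zeta : 0 < stab_law p rule xi zeta ->
  exists n, 0 < stab_within p rule n [::] xi zeta.
Proof.
apply: contraPP => none; apply/negP; rewrite -leNgt.
apply: limr_le.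
  by apply/cvg_ex; exists (stab_law p rule xi zeta); exact: stab_law_cvg.
apply: nearW => n; rewrite leNgt; apply/negP => h.
by apply: none; exists n.
Qed.

Lemma stab_within_legal_path n past xi zeta :
  0 < stab_within p rule n past xi zeta -> exists k, legal_path k xi zeta.
Proof.
elim: n past xi => [|n IH] past xi; have [st|st] := boolP (stable xi).
- rewrite stab_within_stable //; case: eqP => [-> _|]; rewrite ?ltxx //.
  by exists 0%N; exact: LegalNil.
- by rewrite stab_within0 ?ltxx.
- rewrite stab_within_stable //; case: eqP => [-> _|]; rewrite ?ltxx //.
  by exists 0%N; exact: LegalNil.
rewrite stab_withinS // => /lt0r_neq0/eqP h.
case: (psumr_neq0P _ h) => [S _|S /andP[Sx hS]].
  by rewrite mulr_ge0 ?stab_within_ge0 // ltW // bernoulli_weight_gt0.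
have [|k hk] := IH (xi :: past) (topple xi (rule xi past) S).
  rewrite lt0r stab_within_ge0 andbT.
  by apply: contraTneq hS => ->; rewrite mulr0 ltxx.
by exists k.+1; apply: LegalCons hk => //; exact: rule_legal.
Qed.

(* By the pulling lemma, the topplings prescribed by the rule can be assumed to
   come first in the legal path, so they are followed with positive probability. *)
Lemma legal_path_stab_within k past xi (delta : config G) zeta :
  legal_path k (addc xi delta) zeta ->
  exists n eta l, 0 < stab_within p rule n past xi eta /\
    legal_path l (addc eta delta) zeta.
Proof.
elim: k past xi => [|k IH] past xi hp; have [st|st] := boolP (stable xi);
  try by exists 0%N, (StableConfig st); eexists; split; [
    rewrite stab_within_stable //= eqxx ltr01 | exact: hp].
all: have leg := rule_legal past st.
all: have unst : (deg (rule xi past) < addc xi delta (rule xi past))%N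
  by rewrite ffunE; apply: leq_trans leg _; exact: leq_addr.
(* An empty path is impossible here, as the final configuration is stable. In the other case, [T] is
   the outcome to follow at the vertex chosen by the rule. *)
all: have [m em [T Tx hT]] := legal_path_pull hp (config_ofP zeta) unst => //.
case: em hT => <-; rewrite topple_addc ?(legal_card_le leg) // => hT.
have [n [eta [l [hn hl]]]] := IH (xi :: past) _ hT.
exists n.+1, eta, l; split => //; rewrite stab_withinS // (bigD1 T) //=.
apply: ltr_pwDl; first by rewrite mulr_gt0 // bernoulli_weight_gt0.
apply: sumr_ge0 => S _.
by rewrite mulr_ge0 ?stab_within_ge0 // ltW // bernoulli_weight_gt0.
Qed.

(** * Geometric decay of the probability of not stabilizing *)

Section AlmostSure.
Variable d : option (vertex G) -> nat.
Hypothesis dP : distance_to_sink d.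

(** Sending a single grain towards the sink has probability at least [weight_bound] and lowers the
    potential, so [n] such steps suffice. *)
Lemma stab_mass_ge n past xi : (potential d xi <= n)%N ->
  weight_bound ^+ n <= stab_mass n past xi.
Proof.
have step xi' past' : ~~ stable xi' -> exists2 e, e \in edges_at (rule xi' past') &
    (potential d (topple xi' (rule xi' past') [set e]%SET) < potential d xi')%N.
  move=> st; have leg := rule_legal past' st.
  have [e [b [ee db]]] := dP (rule xi' past').
  exists e; first by rewrite inE ee !inE eqxx.
  by apply: potential_topple ee db; apply: leq_ltn_trans leg.
have wb1 : weight_bound <= 1.
  have p0 : 0 <= p by exact: ltW.
  have q0 : 0 <= 1 - p by rewrite subr_ge0 ltW.
  by rewrite exprn_ile1 ?mulr_ge0 ?mulr_ile1 // ?lerBlDr ?lerDl // ltW.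
elim: n past xi => [|n IH] past xi hn; have [st|st] := boolP (stable xi).
- by rewrite stab_mass_stable.
- by have [e _] := step xi past st; move: hn; rewrite leqn0 => /eqP ->.
- by rewrite stab_mass_stable // exprn_ile1 // ltW // weight_bound_gt0.
have [e ex he] := step xi past st.
rewrite stab_massS // (bigD1 [set e]%SET) ?finset.sub1set //= exprS.
rewrite -[leLHS]addr0; apply: lerD.
  have w0 := ltW weight_bound_gt0.
  apply: ler_pM => //; [exact: exprn_ge0 | exact: bernoulli_weight_ge |].
  by apply: IH; rewrite -ltnS; apply: leq_trans he hn.
apply: sumr_ge0 => S _.
by rewrite mulr_ge0 ?stab_mass_ge0 // ltW // bernoulli_weight_gt0.
Qed.

(** The analogue of [avoidD]. The rule may depend on the history, so the bound is assumed for every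
    [past]; it is needed only up to mass [M], which topplings preserve. *)
Lemma stab_mass_fail_add M b m n :
  (forall past xi, (mass xi <= M)%N -> 1 - stab_mass n past xi <= b) ->
  forall past xi, (mass xi <= M)%N ->
    1 - stab_mass (m + n) past xi <= (1 - stab_mass m past xi) * b.
Proof.
move=> hb; elim: m => [|m IH] past xi hM; have [st|st] := boolP (stable xi).
- by rewrite !stab_mass_stable // subrr mul0r.
- by rewrite stab_mass0 // subr0 mul1r hb.
- by rewrite !stab_mass_stable // subrr mul0r.
rewrite addSn !stab_mass_failS // mulr_suml; apply: ler_sum => S Sx.
rewrite -mulrA ler_wpM2l //; first by rewrite ltW // bernoulli_weight_gt0.
apply: IH; apply: leq_trans hM; apply: mass_topple => //.
exact: legal_card_le (rule_legal _ st) Sx.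
Qed.

(** Every block of [K] topplings stabilizes with probability at least [1 - r], so failure after
    [j * K] steps has probability at most [r ^+ j]. *)
Lemma stab_law_sum1 xi : \sum_zeta stab_law p rule xi zeta = 1.
Proof.
set K := (mass xi * max_depth d)%N; set r := 1 - weight_bound ^+ K.
have w0 : 0 < weight_bound ^+ K by rewrite exprn_gt0 // weight_bound_gt0.
have fail past xi' : (mass xi' <= mass xi)%N -> 1 - stab_mass K past xi' <= r.
  move=> hM; rewrite lerD2l lerN2; apply: stab_mass_ge.
  by apply: leq_trans (potential_le_mass _ _) _; rewrite leq_mul2r hM orbT.
have r0 : 0 <= r by apply: le_trans (fail [::] xi (leqnn _)); rewrite subr_ge0 stab_mass_le1.
have hj j past xi' : (mass xi' <= mass xi)%N ->
    1 - stab_mass (j * K) past xi' <= r ^+ j.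
  elim: j past xi' => [|j IH] past xi' hM.
    by rewrite expr0 lerBlDr lerDl stab_mass_ge0.
  rewrite mulSn exprS; apply: le_trans (stab_mass_fail_add K IH past hM) _.
  by rewrite ler_wpM2r ?exprn_ge0 // fail.
have cv : (fun n => stab_mass n [::] xi) @ \oo --> \sum_zeta stab_law p rule xi zeta.
  by apply: (cvg_big (op := +%R)) => [|zeta _]; [exact: add_continuous | exact: stab_law_cvg].
apply/eqP; rewrite eq_le; apply/andP; split.
  rewrite -(cvg_lim _ cv) //; apply: limr_le; first by apply/cvg_ex; eexists; exact: cv.
  by apply: nearW => n; exact: stab_mass_le1.
rewrite -subr_le0.
have rcv : (GRing.exp r : R ^nat) @ \oo --> (0 : R).
  by apply: cvg_expr; rewrite ger0_norm // ltrBlDr ltrDl.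
rewrite -[leRHS](cvg_lim _ rcv) //; apply: limr_ge; first by apply/cvg_ex; exists 0.
apply: nearW => j; apply: le_trans (hj j [::] xi (leqnn _)).
rewrite lerD2l lerN2; apply: ler_sum => zeta _; exact: stab_within_le_law.
Qed.

End AlmostSure.
End Stabilization.

(** * The sandpile chain *)

Section Chain.
Variables (R : realType) (G : sink_graph) (p : R) (rule : toppling_rule G).
Variable mu : vertex G -> R.
Hypotheses (p_gt0 : 0 < p) (p_lt1 : p < 1) (rule_legal : legal_rule rule).
Hypothesis mu_gt0 : forall v, 0 < mu v.
Local Notation P := (transition p rule mu).
Implicit Types eta zeta : stable_config G.

Lemma transition_ge0 eta zeta : 0 <= P eta zeta.
Proof.
apply: sumr_ge0 => v _; rewrite mulr_ge0 ?stab_law_ge0 //; exact: ltW.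
Qed.

Lemma transition_sum1 (conn : connected_graph G) (mu_sum1 : \sum_v mu v = 1) eta :
  \sum_zeta P eta zeta = 1.
Proof.
have [d dP] := distance_to_sink_exists conn.
rewrite exchange_big -mu_sum1; apply: eq_bigr => v _.
by rewrite -mulr_sumr (stab_law_sum1 p_gt0 p_lt1 rule_legal dP) mulr1.
Qed.

(** Induction on the grains still to be added: one grain of [delta] is dropped, the rule stabilizes
    while the others wait in [delta'], and a legal path to [zeta] remains. *)
Lemma accessible_legal_path k (delta : config G) eta zeta :
  legal_path k (addc eta delta) zeta -> accessible P eta zeta.
Proof.
have [N] := ubnP (\sum_v delta v)%N; elim: N => // N IH in k delta eta *.
move=> hN hp; have [/existsP[v dv]|/existsPn d0] := boolP [exists v, (0 < delta v)%N].
  pose delta' : config G := [ffun y => (delta y - (y == v))%N].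
  have e : addc eta delta = addc (add_grain eta v) delta'.
    apply/ffunP => y; rewrite !ffunE; case: eqP => [->|_]; last lia.
    by move: dv; lia.
  rewrite e in hp.
  have [n [eta1 [l [hn hl]]]] :=
    legal_path_stab_within p_gt0 p_lt1 rule_legal [::] hp.
  apply: (accessible_step transition_ge0 (y := eta1)).
    rewrite /transition (bigD1 v) //=; apply: ltr_pwDl.
      rewrite mulr_gt0 //; apply: lt_le_trans hn _; exact: stab_within_le_law.
    by apply: sumr_ge0 => y _; rewrite mulr_ge0 ?stab_law_ge0 // ltW.
  apply: IH hl; move: hN; rewrite (bigD1 v) //= [X in _ -> (X < _)%N](bigD1 v) //=.
  rewrite /delta' ffunE eqxx => hN.
  rewrite (eq_bigr delta) => [|y yv]; last by rewrite ffunE (negbTE yv) subn0.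
  by rewrite subn1 -ltnS -addSn prednK.
have e : addc eta delta = eta.
  by apply/ffunP => y; rewrite ffunE; move: (d0 y); rewrite -eqn0Ngt => /eqP ->; rewrite addn0.
(* With no grain left, the path starts at the stable [eta], hence is empty. *)
rewrite e in hp; suff -> : zeta = eta by exact: accessible_refl.
apply: val_inj; move: (config_ofP eta) hp => /=.
set xi := config_of eta; set xi' := config_of zeta => st hp.
case: hp st => // m xi1 x S xi2 hx _ _ /forallP/(_ x).
by rewrite leqNgt hx.
Qed.

Lemma accessible_eta_max eta : accessible P eta (eta_max G).
Proof.
pose delta : config G := [ffun v : vertex G => (deg v - config_of eta v)%N].
apply: (@accessible_legal_path 0 delta).
suff -> : addc eta delta = eta_max G by exact: LegalNil.
apply/ffunP => v; rewrite !ffunE subnKC //.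
by have /forallP := config_ofP eta; apply.
Qed.

(** Adding a grain keeps the same orientation compatible, and the ensuing stabilization is a legal
    path. *)
Lemma compatible_accessible eta zeta :
  (exists O, compatible O eta) -> accessible P eta zeta ->
  exists O, compatible O zeta.
Proof.
move=> + [n]; elim: n eta => [|n IH] eta [ O cO].
  by rewrite /=; case: eqP => [<- _|]; [exists O | rewrite ltxx].
move=> /(nstepS_gt0 transition_ge0)[xi hxi]; apply: IH.
move: hxi; rewrite /transition => /lt0r_neq0/eqP h.
have term_ge0 v : 0 <= mu v * stab_law p rule (add_grain eta v) xi.
  by rewrite mulr_ge0 ?stab_law_ge0 // ltW.
have [v /andP[_ hv]] := psumr_neq0P (fun v _ => term_ge0 v) h.
have [|n' hn'] := stab_law_gt0 p_gt0 p_lt1 (rule := rule) (xi := add_grain eta v) (zeta := xi).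
  rewrite lt0r stab_law_ge0 // andbT.
  by apply: contraTneq hv => ->; rewrite mulr0 ltxx.
have [k hk] := stab_within_legal_path p_gt0 p_lt1 rule_legal hn'.
apply: compatible_legal_path hk _; exists O; apply/compatibleP => y.
by move/compatibleP: cO => /(_ y); rewrite ffunE; lia.
Qed.

Lemma StoP (conn : connected_graph G) (mu_sum1 : \sum_v mu v = 1) eta :
  Sto p rule mu eta <-> exists O, compatible O eta.
Proof.
have [d dP] := distance_to_sink_exists conn; split.
  case=> _ [acc _]; apply: compatible_accessible acc.
  exact: compatible_eta_max dP.
case=> O cO.
have [delta [k hk]] := compatible_legal_path_from_above dP cO.
have acc := accessible_legal_path hk.
split; last by split => //; exact: accessible_eta_max.
apply: accessible_recurrent; first exact: transition_ge0.
  exact: transition_sum1.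
(* Every state reaches [eta] by passing through [eta_max]. *)
move=> zeta; exact: (accessible_trans transition_ge0 (accessible_eta_max zeta) acc).
Qed.

End Chain.

Theorem theorem3p2 (R : realType) (G : sink_graph) (p : R)
    (rule : toppling_rule G) (mu : vertex G -> R)
    (connG : connected_graph G)
    (p_gt0 : 0 < p) (p_lt1 : p < 1)
    (rule_legal : legal_rule rule)
    (mu_gt0 : forall v, 0 < mu v) (mu_sum1 : \sum_v mu v = 1) :
  (forall eta : stable_config G,
     Sto p rule mu eta <-> exists O : orientation G, compatible O eta) /\
  Sto p rule mu = \bigcup_(O : orientation G) comp_set O.
Proof.
have iffSto eta := StoP p_gt0 p_lt1 rule_legal mu_gt0 connG mu_sum1 eta.
split => //; apply/seteqP; split => eta.
  by move=> /iffSto[ O cO]; exists O.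
by move=> [ O _ cO]; apply/iffSto; exists O.
Qed.
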